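(* Let $E$ be a Euclidean Jordan algebra of rank at most $2$. Then the completely positive cone $\mathcal{CP}(E_+)$ over the cone of squares $E_+$ of $E$ is facially exposed.
   Context: Euclidean Jordan algebra (EJA): a finite-dimensional real vector space $E$ with a commutative bilinear product $\circ$ satisfying $x\circ((x\circ x)\circ y)=(x\circ x)\circ(x\circ y)$ for all $x,y$, with a unit element, and admitting an inner product $\bullet$ with $(x\circ y)\bullet z=x\bullet(y\circ z)$ for all $x,y,z$ (an associative inner product; fix any one). The zero algebra is allowed and has rank $0$. A Jordan frame is a set $\{c_1,\dots,c_r\}$ of nonzero idempotents, none of which is a sum of two nonzero idempotents, with $c_i\circ c_j=0$ for $i\ne j$ and $c_1+\dots+c_r$ equal to the unit; its cardinality $r$ does not depend on the frame and is the rank of $E$. $E_+=\{x\circ x\mid x\in E\}$ is the associated symmetric cone. For a closed cone $K$ in a finite-dimensional real inner product space $V$ (a cone is a set closed under multiplication by all reals $a\ge 0$), $\mathcal{CP}(K)=\{\sum_{i=1}^k a_i\otimes a_i\mid k\ge1,\ a_i\in K\}$, where $x\otimes x$ is the self-adjoint linear map $y\mapsto (x\bullet y)x$ on $V$. It lies in the space $\mathcal{S}(V)$ of self-adjoint linear transformations on $V$, with the induced inner product. A face of a closed convex cone $C$ is a nonempty convex subcone $F\subseteq C$ such that $a,b\in C$ and $a+b\in F$ imply $a,b\in F$. An exposed face is a set $C\cap\{d\}^\perp$ with $d$ in the dual cone $C^*=\{y\mid \langle x,y\rangle\ge0\ \forall x\in C\}$. $C$ is facially exposed if all its faces are exposed.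 (Facial exposedness of $\mathcal{CP}(E_+)$ does not depend on the chosen associative inner product.) *)

(* Defs.v *)
From HB Require Import structures.
From mathcomp Require Import all_boot all_order all_algebra.
From mathcomp Require Import classical_sets reals convex.

Set Implicit Arguments.
Unset Strict Implicit.
Unset Printing Implicit Defensive.

Import Order.TTheory GRing.Theory Num.Theory.
Local Open Scope classical_set_scope.
Local Open Scope ring_scope.

(* The inner product is part of the structure, so that a statement about every
   [J : eja E] is a statement about every choice of associative inner product.
   The zero algebra is not excluded: [eja_one] may be [0]. *)
Record eja (R : realType) (E : vectType R) := Eja {
  eja_mul : {bilinear E -> E -> E};
  eja_one : E;
  eja_dot : {dot E for idfun};
  eja_mulC : forall x y, eja_mul x y = eja_mul y x;
  eja_jordan : forall x y,
    eja_mul x (eja_mul (eja_mul x x) y) = eja_mul (eja_mul x x) (eja_mul x y);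
  eja_mul1 : forall x, eja_mul eja_one x = x;
  eja_dotA : forall x y z,
    eja_dot (eja_mul x y) z = eja_dot x (eja_mul y z)
}.

Section JordanFrames.
Variables (R : realType) (E : vectType R) (J : eja E).

Definition nonzero_idempotent (c : E) := c <> 0 /\ eja_mul J c c = c.

Definition primitive_idempotent (c : E) :=
  nonzero_idempotent c /\
  ~ (exists a b, [/\ nonzero_idempotent a, nonzero_idempotent b & c = a + b]).

(* A frame is indexed by ['I_r]; orthogonality and nonvanishing make the family
   injective, so [r] is the cardinality of the set it enumerates. *)
Definition jordan_frame (r : nat) (c : 'I_r -> E) :=
  [/\ forall i, primitive_idempotent (c i),
      forall i j, i <> j -> eja_mul J (c i) (c j) = 0
    & \sum_i c i = eja_one J].

Definition eja_has_rank (r : nat) :=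
  exists c : 'I_r -> E, jordan_frame c.

Definition cone_of_squares : set E := [set eja_mul J x x | x in setT].

End JordanFrames.

Section SelfAdjoint.
Variables (R : realType) (V : vectType R) (dot : {dot V for idfun}).

Definition self_adjoint : set 'End(V) :=
  [set A | forall x y, dot (A x) y = dot x (A y)].

(* [mxof] uses row vectors, which transposes the matrix but not its trace; the
   trace does not depend on the basis. *)
Definition lf_trace (A : 'End(V)) : R :=
  \tr (passmx.mxof (vbasis {:V}) (vbasis {:V}) A).

(* The inner product induced on self-adjoint maps: the pairing of [x (x) x]
   and [y (x) y] is [dot x y ^+ 2]. *)
Definition trace_form (A B : 'End(V)) : R := lf_trace (A \o B)%VF.

Definition tensor_square_fun (x y : V) : V := dot x y *: x.

Lemma tensor_square_fun_linear x : linear (tensor_square_fun x).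
Proof.
by move=> a u v; rewrite /tensor_square_fun linearPr /= scalerDl scalerA.
Qed.

HB.instance Definition _ x := GRing.isSemilinear.Build R V V _
  (tensor_square_fun x) (GRing.semilinear_linear (tensor_square_fun_linear x)).

Definition tensor_square (x : V) : 'End(V) := linfun (tensor_square_fun x).

Lemma tensor_squareE x y : tensor_square x y = dot x y *: x.
Proof. by rewrite lfunE. Qed.

Definition completely_positive_cone (K : set V) : set 'End(V) :=
  [set A | exists k (a : 'I_k.+1 -> V),
     (forall i, K (a i)) /\ A = \sum_i tensor_square (a i)].

End SelfAdjoint.

(* Convex cones in a linear subspace [S] of [W], where [form] restricts to an
   inner product on [S] but need not be one on [W]; duality is taken in [S]. *)
Section Faces.
Variables (R : realType) (W : lmodType R).
Variables (S : set W) (form : W -> W -> R).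
Implicit Types C F : set W.

Definition is_cone C := forall (a : R) x, 0 <= a -> C x -> C (a *: x).

Definition is_face C F :=
  [/\ F !=set0, F `<=` C, is_cone F, convex_set F
    & forall a b, C a -> C b -> F (a + b) -> F a /\ F b].

Definition dual_cone C : set W :=
  [set y | S y /\ forall x, C x -> 0 <= form x y].

Definition is_exposed_face C F :=
  exists2 d, dual_cone C d & F = C `&` [set x | form x d = 0].

Definition facially_exposed C :=
  forall F, is_face C F -> is_exposed_face C F.

End Faces.

(* Main.v *)
Require Import Defs.
From mathcomp Require Import all_boot all_order all_algebra.
From mathcomp Require Import classical_sets reals.
From mathcomp Require Import boolp interval_inference convex.
From mathcomp Require Import topology normedtype derive.
From mathcomp Require Import ring lra.

(** In rank at most [2], membership in the cone of squares is governed by one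
    quadratic form: every [x] satisfies [x^2 = tr(x) x - det(x) e], and
    [det x >= 0] holds exactly when [x] or [-x] is a square.  As [x (x) x] does
    not see the sign of [x], the completely positive cone then consists of all
    sums of [x (x) x] with [det x >= 0].  The rest of the argument is about an
    arbitrary quadratic form [Q] on a Euclidean space.

    Facial exposedness ([cp_facially_exposed]).  Given a face [F], let [T] be
    the set of the [x] with [Q x >= 0] and [x (x) x] in [F], and let [P] be a
    positive semidefinite map with kernel [span T].  If [Q] is positive
    somewhere on [T], then [P] exposes [F]; otherwise [Q] vanishes on [T] and
    [P + Q] exposes [F].  What has to be shown is that [x (x) x] is in [F] for
    all [x] in [span T] with [Q x >= 0], where [Q x = 0] is required in the
    second case.  To this end [e x (x) x], for a small [e > 0], is subtracted
    from a sum [A] of squares of elements of [T] that span the space.  The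
    difference is again a sum of squares, on which the total of [Q] is still
    nonnegative ([shave_tensor]).  Rotating pairs of vectors on which [Q] has
    opposite signs turns it into a sum of squares on each of which [Q] is
    nonnegative ([regroup_nonneg]).  Hence it lies in the cone, and the face
    property applies to [A].

    The quadratic equation ([quadratic_trace_rank_le2]).  In rank [2], with a
    Jordan frame [c1, c2], the Peirce decomposition with respect to [c1] writes
    [x] as the sum of an element of the [1]-space of [c1], one of the [1]-space
    of [c2], and some [z] in the common half-space; the square of [z] is a
    multiple of the unit.  It remains to see that the Peirce [1]-space of a
    primitive idempotent [c] is the line of [c] ([primitive_peirce1]).  Maximise
    the cubic form [<x^2, x>] on the unit sphere of this space.  A maximiser is
    a critical point, so it is proportional to an idempotent, and primitivity
    forces this idempotent to be [c].  But at [c] the cubic form has a strict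
    local minimum as soon as the space is larger than a line. *)

Set Implicit Arguments.
Unset Strict Implicit.
Unset Printing Implicit Defensive.

Import Order.TTheory GRing.Theory Num.Theory passmx numFieldNormedType.Exports.
Local Open Scope classical_set_scope.
Local Open Scope ring_scope.

(** * Inner products and tensor squares *)

Section InnerProduct.
Variables (R : realType) (V : vectType R) (dot : {dot V for idfun}).
Local Notation "'[ x , y ]" := (dot x y).

Lemma dotC x y : '[x, y] = '[y, x].
Proof. by rewrite (hermC dot) /= expr0 mul1r. Qed.

Lemma dotDl x y z : '[x + y, z] = '[x, z] + '[y, z].
Proof. exact: linearDl. Qed.
Lemma dotDr x y z : '[x, y + z] = '[x, y] + '[x, z].
Proof. exact: linearDr. Qed.
Lemma dotBl x y z : '[x - y, z] = '[x, z] - '[y, z].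
Proof. exact: linearBl. Qed.
Lemma dotBr x y z : '[x, y - z] = '[x, y] - '[x, z].
Proof. exact: linearBr. Qed.
Lemma dotZl a x y : '[a *: x, y] = a * '[x, y].
Proof. exact: linearZl_LR. Qed.
Lemma dotZr a x y : '[x, a *: y] = a * '[x, y].
Proof. exact: linearZr_LR. Qed.
Lemma dotNl x y : '[- x, y] = - '[x, y].
Proof. exact: linearNl. Qed.
Lemma dotNr x y : '[x, - y] = - '[x, y].
Proof. exact: linearNr. Qed.
Lemma dot0l x : '[0, x] = 0.
Proof. exact: linear0l. Qed.
Lemma dot0r x : '[x, 0] = 0.
Proof. exact: linear0r. Qed.

Definition dotE := (dotDl, dotDr, dotBl, dotBr, dotNl, dotNr, dotZl, dotZr,
  dot0l, dot0r).

Lemma dot_gt0 x : x != 0 -> 0 < '[x, x].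
Proof. exact: neq0_dnorm_gt0. Qed.

Lemma dot_ge0 x : 0 <= '[x, x].
Proof.
by have [->|/dot_gt0/ltW//] := eqVneq x 0; rewrite dot0l.
Qed.

Lemma dot_eq0 x : '[x, x] = 0 -> x = 0.
Proof.
move=> x0; apply/eqP; apply: contraT => /dot_gt0.
by rewrite x0 ltxx.
Qed.

(** Reduces linear identities between vectors to identities between scalars. *)
Lemma dot_ext x y : (forall w, '[x, w] = '[y, w]) -> x = y.
Proof.
move=> xy; apply/eqP; rewrite -subr_eq0; apply/eqP/dot_eq0.
by rewrite dotBl xy subrr.
Qed.

Lemma self_adjointP (A : 'End(V)) x y :
  self_adjoint dot A -> '[A x, y] = '[A y, x].
Proof. by move=> sA; rewrite sA dotC. Qed.

Lemma self_adjointD (A B : 'End(V)) :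
  self_adjoint dot A -> self_adjoint dot B -> self_adjoint dot (A + B).
Proof. by move=> sA sB x y; rewrite !add_lfunE !dotE sA sB. Qed.

Lemma self_adjointZ a (A : 'End(V)) :
  self_adjoint dot A -> self_adjoint dot (a *: A).
Proof. by move=> sA x y; rewrite !scale_lfunE !dotE sA. Qed.

Lemma self_adjoint_id : self_adjoint dot \1%VF.
Proof. by move=> x y; rewrite !id_lfunE. Qed.

Lemma self_adjoint_tensor v : self_adjoint dot (tensor_square dot v).
Proof. by move=> x y; rewrite !tensor_squareE !dotE (dotC x v); ring. Qed.

Lemma tensor_squareN v : tensor_square dot (- v) = tensor_square dot v.
Proof.
by apply/lfunP => y; rewrite !tensor_squareE dotE scalerN scaleNr opprK.
Qed.

Lemma tensor_square0 : tensor_square dot 0 = 0.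
Proof. by apply/lfunP => y; rewrite tensor_squareE scaler0 zero_lfunE. Qed.

Lemma trace_formDl (A B C : 'End(V)) :
  trace_form (A + B) C = trace_form A C + trace_form B C.
Proof.
by rewrite /trace_form /lf_trace comp_lfunDl !linearD.
Qed.

Lemma trace_formZl a (A C : 'End(V)) :
  trace_form (a *: A) C = a * trace_form A C.
Proof. by rewrite /trace_form /lf_trace -comp_lfunZl !linearZ. Qed.

Lemma trace_form0l (C : 'End(V)) : trace_form 0 C = 0.
Proof. by rewrite /trace_form /lf_trace comp_lfun0l !linear0. Qed.

(** Expanding [x] in the basis that computes the trace, the diagonal entries are
    the terms of the expansion of [<d x, x>]. *)
Lemma trace_form_tensor x (d : 'End(V)) : self_adjoint dot d ->
  trace_form (tensor_square dot x) d = '[d x, x].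
Proof.
move=> sd; rewrite /trace_form /lf_trace /mxtrace.
set b := vbasis _.
have bB : basis_of {:V} b := vbasisP _.
transitivity '[d x, \sum_i coord b i x *: b`_i]; last first.
  by rewrite -(coord_basis bB (memvf x)).
rewrite linear_sumr; apply: eq_bigr => i _ /=.
rewrite !mxE /= passmx.vecof_delta comp_lfunE tensor_squareE linearZ /= dotZr.
by rewrite sd mulrC.
Qed.

End InnerProduct.

Section TensorSquares.
Variables (R : realType) (V : vectType R) (dot : {dot V for idfun}).
Local Notation "'[ x , y ]" := (dot x y).
Local Notation tsq := (tensor_square dot).

Definition sum_tensor (s : seq V) : 'End(V) := \sum_(x <- s) tsq x.

Lemma sum_tensor_cons x s : sum_tensor (x :: s) = tsq x + sum_tensor s.
Proof. by rewrite /sum_tensor big_cons. Qed.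

Lemma trace_form_sum s d : self_adjoint dot d ->
  trace_form (sum_tensor s) d = \sum_(x <- s) '[d x, x].
Proof.
move=> sd; elim: s => [|x s IH]; first by rewrite /sum_tensor !big_nil trace_form0l.
by rewrite sum_tensor_cons big_cons trace_formDl trace_form_tensor// IH.
Qed.

(** A sum of two tensor squares depends on the pair of vectors only up to a
    rotation in the plane of coefficients. *)
Lemma rotate_tensor c s a b : c ^+ 2 + s ^+ 2 = 1 ->
  tsq (c *: a + s *: b) + tsq (c *: b - s *: a) = tsq a + tsq b.
Proof.
move=> cs; apply/lfunP => y; rewrite !add_lfunE !tensor_squareE.
apply: (@dot_ext _ _ dot) => w; rewrite !dotE.
transitivity ((c ^+ 2 + s ^+ 2) * ('[a, y] * '[a, w] + '[b, y] * '[b, w])).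
  ring.
by rewrite cs mul1r.
Qed.

(** Adding a vector [v] to the kernel is a Schur complement: subtracting
    [Pv (x) Pv / <Pv, v>] changes the form of [P] at [x] into its value at [x]
    minus the multiple of [v] that makes the result [P]-orthogonal to [v]. *)
Lemma psd_with_kernel (s : seq V) : exists P : 'End(V),
  [/\ self_adjoint dot P, forall x, 0 <= '[P x, x],
      forall x, '[P x, x] = 0 -> x \in <<s>>%VS
    & forall x, x \in <<s>>%VS -> P x = 0].
Proof.
elim: s => [|v s [P [sP P0 Pin Pker]]].
  exists \1%VF; split.
  - exact: self_adjoint_id.
  - by move=> x; rewrite id_lfunE dot_ge0.
  - by move=> x; rewrite id_lfunE span_nil memv0 => /dot_eq0 ->.
  - by move=> x; rewrite id_lfunE span_nil memv0 => /eqP.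
pose m := '[P v, v].
(* If [m = 0] then [v] is already in the span and, as [0^-1 = 0], [P' = P]. *)
pose P' := P + (- m^-1) *: tsq (P v).
have P'E x : P' x = P x - (m^-1 * '[P v, x]) *: P v.
  by rewrite add_lfunE scale_lfunE tensor_squareE scalerA mulNr scaleNr.
have P'q x : '[P' x, x] = '[P (x - (m^-1 * '[P v, x]) *: v),
                             x - (m^-1 * '[P v, x]) *: v].
  rewrite P'E (linearB P) (linearZ_LR P) /= !dotE (self_adjointP x v sP) -/m.
  have [->|m0] := eqVneq m 0; first by rewrite invr0; ring.
  by field.
exists P'; split.
- apply: self_adjointD => //; apply: self_adjointZ; exact: self_adjoint_tensor.
- by move=> x; rewrite P'q.
- move=> x; rewrite P'q span_cons => /Pin xin.
  rewrite -(subrK ((m^-1 * '[P v, x]) *: v) x) addrC.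
  by apply: memv_add => //; rewrite memvZ ?memv_line.
- move=> x; rewrite span_cons => /memv_addP [_ /vlineP[k ->] [y ys ->]].
  rewrite (linearD P') (linearZ_LR P') /= P'E (P'E y) (Pker y ys) sub0r (sP v y).
  rewrite (Pker y ys) dot0r mulr0 scale0r oppr0 addr0 -/m.
  have [m0|m0] := eqVneq m 0.
    by rewrite (Pker v (Pin v m0)) !scaler0 subr0 scaler0.
  by rewrite mulVf// scale1r subrr scaler0.
Qed.

(** * Sums of squares on which a quadratic form is nonnegative *)

Section QuadraticForm.
Variables (D : 'End(V)) (sD : self_adjoint dot D).
Local Notation Q x := ('[D x, x]).

Lemma quadD a b c s : Q (c *: a + s *: b) =
  c ^+ 2 * Q a + 2 * c * s * '[D a, b] + s ^+ 2 * Q b.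
Proof.
by rewrite (linearD D) !(linearZ_LR D) /= !dotE (self_adjointP b a sD); ring.
Qed.

Lemma isotropic_rotation a b : 0 < Q a -> Q b < 0 ->
  exists c s, c ^+ 2 + s ^+ 2 = 1 /\ Q (c *: a + s *: b) = 0.
Proof.
move=> a0 b0; set B := '[D a, b].
have disc_ge0 : 0 <= B ^+ 2 - Q a * Q b by nra.
pose t := (- B - Num.sqrt (B ^+ 2 - Q a * Q b)) / Q b.
have Qt : Q a + 2 * t * B + t ^+ 2 * Q b = 0.
  have -> : Q a + 2 * t * B + t ^+ 2 * Q b =
      (Num.sqrt (B ^+ 2 - Q a * Q b) ^+ 2 - (B ^+ 2 - Q a * Q b)) / Q b.
    by rewrite /t; field; rewrite lt_eqF.
  by rewrite sqr_sqrtr// subrr mul0r.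
have k_gt0 : 0 < 1 + t ^+ 2 by nra.
pose c := (Num.sqrt (1 + t ^+ 2))^-1.
have c2 : c ^+ 2 * (1 + t ^+ 2) = 1.
  by rewrite /c exprVn sqr_sqrtr ?(ltW k_gt0)// mulVf ?gt_eqF.
exists c, (t * c); split; first by rewrite -[RHS]c2; ring.
rewrite quadD -/B.
transitivity (c ^+ 2 * (Q a + 2 * t * B + t ^+ 2 * Q b)); first ring.
by rewrite Qt mulr0.
Qed.

(** Sturm and Zhang's rank-one decomposition: as long as some vector has [Q < 0],
    another one has [Q > 0], and the pair can be rotated so that [Q] vanishes on
    one of the two new vectors.  That vector is set aside; the others are fewer
    and keep the same total. *)
Lemma regroup_nonneg (s : seq V) : 0 <= \sum_(x <- s) Q x ->
  exists s', (forall x, x \in s' -> 0 <= Q x) /\ sum_tensor s' = sum_tensor s.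
Proof.
have [n] := ubnP (size s); elim: n s => // n IH s sn s_ge0.
have [/allP s_nonneg|/allPn[b bs]] := boolP (all (fun x => 0 <= Q x) s).
  by exists s.
rewrite -ltNge => b0.
have [/hasP[a as_ a0]|/hasPn s_nonpos] := boolP (has (fun x => 0 < Q x) s);
  last first.
  move: s_ge0; rewrite (big_rem b)//= leNgt => /negP[].
  rewrite -[ltRHS]addr0; apply: ltr_leD => //.
  rewrite big_seq; apply: sumr_le0 => x /mem_rem xs.
  by rewrite leNgt s_nonpos.
have abs : a \in rem b s.
  move: as_; rewrite (perm_mem (perm_to_rem bs)) inE => /predU1P[ab|//].
  by move: a0; rewrite ab => /(lt_trans b0); rewrite ltxx.
have sP : perm_eq s [:: b, a & rem a (rem b s)].
  by rewrite (perm_trans (perm_to_rem bs))// perm_cons perm_to_rem.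
have [c [t [ct Qu]]] := isotropic_rotation a0 b0.
set r := rem a (rem b s) in sP *.
set u := c *: a + t *: b in Qu; pose w := c *: b - t *: a.
have Qw : Q w = Q a + Q b.
  have -> : Q w = (c ^+ 2 + t ^+ 2) * (Q a + Q b) - Q u.
    by rewrite /w addrC -scaleNr !quadD; ring.
  by rewrite ct mul1r Qu subr0.
have [||s' [s'0 s'E]] := IH (w :: r).
- by move: sn; rewrite (perm_size sP) /= !ltnS.
- by move: s_ge0; rewrite (perm_big _ sP) /= !big_cons Qw addrCA addrA.
exists (u :: s'); split.
  by move=> x; rewrite inE => /predU1P[->|/s'0//]; rewrite Qu.
rewrite sum_tensor_cons s'E sum_tensor_cons addrA rotate_tensor//.
by rewrite /sum_tensor (perm_big _ sP) /= !big_cons addrCA addrA.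
Qed.

(** Write [x = sum_i t_i a_i] with [a_i] the entries of [s].  Replacing every
    [a_i] by [a_i - c t_i x] subtracts [(2c - c^2 |t|^2) x (x) x] from the sum of
    the squares of the [a_i], which is a small positive multiple of [x (x) x] for
    small [c > 0].  The total of [Q] drops by the same multiple of [Q x], hence
    stays nonnegative under the last hypothesis. *)
Lemma shave_tensor (s : seq V) x : x \in <<s>>%VS ->
  0 <= \sum_(y <- s) Q y -> 0 <= Q x ->
  Q x = 0 \/ 0 < \sum_(y <- s) Q y ->
  exists e s', [/\ 0 < e, forall y, y \in s' -> 0 <= Q y
    & sum_tensor s = sum_tensor s' + e *: tsq x].
Proof.
move=> xs s0 x0 xs0.
pose X := in_tuple s; pose t (i : 'I_(size s)) : R := coord X i x.
have xE : x = \sum_i t i *: X`_i by rewrite -coord_span.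
pose tau := \sum_i t i ^+ 2.
have tau0 : 0 <= tau by apply: sumr_ge0 => i _; apply: sqr_ge0.
set M := \sum_(y <- s) Q y in s0 xs0.
pose e c := 2 * c - c ^+ 2 * tau.
pose s1 c := [seq X`_i - (c * t i) *: x | i : 'I_(size s) <- enum 'I_(size s)].
have sumX (U : nmodType) (f : V -> U) : \sum_(y <- s) f y = \sum_(i < size s) f X`_i.
  by rewrite (big_nth 0) big_mkord.
have sumE (U : nmodType) (f : V -> U) c :
    \sum_(y <- s1 c) f y = \sum_(i < size s) f (X`_i - (c * t i) *: x).
  by rewrite big_map big_enum.
have s1E c : sum_tensor (s1 c) = sum_tensor s - e c *: tsq x.
  rewrite /sum_tensor sumX sumE.
  apply/lfunP => y; rewrite add_lfunE opp_lfunE !sum_lfunE scale_lfunE.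
  apply: (@dot_ext _ _ dot) => w; rewrite !dotE !linear_sumlz /=.
  rewrite tensor_squareE dotZl.
  have -> : \sum_(i < size s) '[tsq (X`_i - (c * t i) *: x) y, w] =
    \sum_(i < size s) ('[tsq X`_i y, w] - c * '[x, w] * '[t i *: X`_i, y]
       - c * '[x, y] * '[t i *: X`_i, w] + c ^+ 2 * '[x, y] * '[x, w] * t i ^+ 2).
    by apply: eq_bigr => i _; rewrite !tensor_squareE !dotE; ring.
  rewrite !big_split /= !sumrN -!mulr_sumr -!linear_sumlz -xE -/tau /e; ring.
have Q1E c : \sum_(y <- s1 c) Q y = M - e c * Q x.
  rewrite -(trace_form_sum _ sD) s1E.
  rewrite -scaleNr trace_formDl trace_formZl trace_form_sum//.
  by rewrite trace_form_tensor// mulNr.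
have [c [e0 cM]] : exists c, 0 < e c /\ e c * Q x <= M.
  case: xs0 => [->|M0].
    exists (1 + tau)^-1; rewrite mulr0; split => //.
    have k0 : 0 < 1 + tau by lra.
    have -> : e (1 + tau)^-1 = (2 + tau) / (1 + tau) ^+ 2.
      by rewrite /e; field; rewrite gt_eqF.
    by apply: divr_gt0; [lra|rewrite exprn_gt0].
  (* [c = M / k] satisfies [c tau <= 1], so that [e c > 0], and [2 c Q x <= M],
     so that the total of [Q] drops by at most [M]. *)
  set k := M + tau * M + 2 * Q x.
  have k0 : 0 < k by rewrite /k; nra.
  exists (M / k).
  have -> : e (M / k) = (2 * k - tau * M) * M / k ^+ 2.
    by rewrite /e; field; rewrite gt_eqF.
  have tM : 0 <= tau * M by nra.
  split.
    by apply: divr_gt0; rewrite ?exprn_gt0// mulr_gt0// /k; lra.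
  rewrite mulrAC ler_pdivrMr ?exprn_gt0//.
  have kM : 0 <= k * M * (k - 2 * Q x).
    by rewrite !mulr_ge0 ?(ltW k0)// /k; lra.
  have : 0 <= tau * M * M * Q x by rewrite !mulr_ge0.
  have -> : M * k ^+ 2 = k * M * (k - 2 * Q x) + k * M * (2 * Q x) by ring.
  have -> : (2 * k - tau * M) * M * Q x = k * M * (2 * Q x) - tau * M * M * Q x by ring.
  lra.
have [|s' [s'0 s'E]] := @regroup_nonneg (s1 c); first by rewrite Q1E subr_ge0.
by exists (e c), s'; split => //; rewrite s'E s1E subrK.
Qed.

End QuadraticForm.

End TensorSquares.

(** * Exposing faces *)

Lemma spanning_seq (R : realType) (V : vectType R) (T : set V) :
  exists s : seq V, (forall x, x \in s -> T x) /\
    (forall x, T x -> x \in <<s>>%VS).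
Proof.
suff: forall n (s : seq V), (forall x, x \in s -> T x) ->
    (\dim {:V} - \dim <<s>> < n)%N ->
    exists s, (forall x, x \in s -> T x) /\ (forall x, T x -> x \in <<s>>%VS).
  by move=> /(_ _ [::]) H; apply: H => //.
elim=> // n IH s sT sn.
have [Ts|/existsNP[x /not_implyP[Tx /negP xs]]] :=
  pselect (forall x, T x -> x \in <<s>>%VS); first by exists s.
apply: (IH (x :: s)) => [y|]; first by rewrite inE => /predU1P[->|/sT].
have lt_dim : (\dim <<s>> < \dim <<x :: s>>)%N.
  rewrite span_cons ltnNge; apply: contra xs => dim_le.
  have /eqP-> : (<<s>> == <[x]> + <<s>>)%VS by rewrite eqEdim addvSr.
  by rewrite (subvP (addvSl _ _)) ?memv_line.
have dim_le : (\dim <<x :: s>> <= \dim {:V})%N by rewrite dimvS ?subvf.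
by rewrite -ltnS; apply: leq_trans sn; rewrite ltnS ltn_sub2l// (leq_trans lt_dim).
Qed.

Section ConvexCone.
Variables (R : realType) (W : lmodType R) (F : set W).
Hypotheses (coneF : is_cone F) (convF : convex_set F).

Lemma convex_coneD a b : F a -> F b -> F (a + b).
Proof.
move=> Fa Fb.
have half0 : 0 <= 2^-1 :> R by rewrite invr_ge0.
have half1 : 2^-1 <= 1 :> R by lra.
have /set_mem /(coneF (ler0n R 2)) :=
  convF (Itv01 half0 half1) (mem_set Fa) (mem_set Fb).
suff -> : 2 *: ((2^-1 : R) *: a + (1 - 2^-1 : R) *: b) = a + b by [].
rewrite scalerDr !scalerA; congr (_ + _); rewrite -[RHS]scale1r; congr (_ *: _).
  by field.
by field.
Qed.

End ConvexCone.

Section Faces.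
Variables (R : realType) (V : vectType R) (dot : {dot V for idfun}).
Local Notation "'[ x , y ]" := (dot x y).
Local Notation tsq := (tensor_square dot).
Variables (D : 'End(V)) (sD : self_adjoint dot D) (K : set V).
Local Notation Q x := ('[D x, x]).
(** The cone [K] enters only through the rays [+x] and [-x], which have the same
    tensor square. *)
Hypothesis KQ : forall x, (K x \/ K (- x)) <-> 0 <= Q x.
Local Notation CP := (completely_positive_cone dot K).

(** Going from right to left, each vector is replaced by whichever of itself and
    its opposite lies in [K]; the zero vector in front provides a term when [s] is
    empty. *)
Lemma cp_sum_tensor A : CP A <->
  exists s, (forall x, x \in s -> 0 <= Q x) /\ A = sum_tensor dot s.
Proof.
split=> [[k [a [Ka ->]]]|[s [s0 ->]]].
  exists (codom a); split.
    by move=> _ /codomP[i ->]; apply/KQ; left.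
  by rewrite /sum_tensor big_image.
pose pos x := if `[< K x >] then x else - x.
have posK x : 0 <= Q x -> K (pos x).
  by move=> /KQ; rewrite /pos; case: asboolP => // ? [].
have pos_tsq x : tsq (pos x) = tsq x.
  by rewrite /pos; case: ifP => // _; rewrite tensor_squareN.
exists (size s), (fun i : 'I_(size s).+1 => pos ((0 :: s)`_i)); split.
  move=> i; apply: posK; case: i => -[|i] /= lti; first by rewrite dot0r.
  by apply: s0; rewrite mem_nth.
rewrite big_ord_recl /= {1}pos_tsq tensor_square0 add0r /sum_tensor.
by rewrite (big_nth 0) big_mkord; apply: eq_bigr => i _; rewrite pos_tsq.
Qed.

Lemma cp_tensor x : 0 <= Q x -> CP (tsq x).
Proof.
move=> x0; apply/cp_sum_tensor; exists [:: x]; split.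
  by move=> y; rewrite inE => /eqP ->.
by rewrite /sum_tensor big_seq1.
Qed.

(** The elements [x] with [x (x) x] in the face [F] are those with [Q x >= 0] in a
    linear subspace, subject to [Q x = 0] if [Q] vanishes on all of them.  A
    semidefinite form that vanishes exactly on the subspace, with [Q] added in the
    second case, exposes [F]. *)
Theorem cp_facially_exposed :
  facially_exposed (self_adjoint dot) (@trace_form R V) CP.
Proof.
move=> F [F0 FC coneF convF faceF].
have FD := convex_coneD coneF convF.
have F_0 : F 0 by have [A /(coneF _ _ (lexx 0))] := F0; rewrite scale0r.
have Fsum s : (forall x, x \in s -> F (tsq x)) -> F (sum_tensor dot s).
  elim: s => [|x s IH] Fs; first by rewrite /sum_tensor big_nil.
  rewrite sum_tensor_cons; apply: FD; first by apply: Fs; rewrite mem_head.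
  by apply: IH => y ys; apply: Fs; rewrite inE ys orbT.
have Fmem s x : (forall y, y \in s -> 0 <= Q y) -> F (sum_tensor dot s) ->
    x \in s -> F (tsq x).
  move=> s0 Fs xs; move: Fs; rewrite /sum_tensor (big_rem x)//=.
  case/faceF => //; first by apply: cp_tensor; apply: s0.
  apply/cp_sum_tensor; exists (rem x s); split => // y /mem_rem.
  exact: s0.
pose T x := 0 <= Q x /\ F (tsq x).
have span_T s x : (forall y, y \in s -> T y) -> x \in <<s>>%VS -> 0 <= Q x ->
    Q x = 0 \/ 0 < \sum_(y <- s) Q y -> F (tsq x).
  move=> sT xs x0 xs0.
  have s0 : 0 <= \sum_(y <- s) Q y.
    by rewrite big_seq; apply: sumr_ge0 => y /sT [].
  have [e [s' [e0 s'0 sE]]] := shave_tensor sD xs s0 x0 xs0.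
  have := Fsum s (fun y ys => (sT y ys).2); rewrite sE => /faceF[].
  - by apply/cp_sum_tensor; exists s'.
  - have -> : e *: tsq x = tsq (Num.sqrt e *: x).
      apply/lfunP => y; rewrite scale_lfunE !tensor_squareE dotZl !scalerA.
      by rewrite mulrAC -expr2 sqr_sqrtr ?ltW.
    apply: cp_tensor; rewrite (linearZ_LR D) /= dotZl dotZr.
    by rewrite !mulr_ge0 ?sqrtr_ge0.
  move=> _ /(coneF e^-1); rewrite scalerA mulVf ?gt_eqF// scale1r; apply.
  by rewrite invr_ge0 ltW.
have [s [sT Ts]] := spanning_seq T.
have [P [sP P0 Pin Pker]] := psd_with_kernel dot s.
have [d [sd d_ge0 dF]] : exists d, [/\ self_adjoint dot d,
    forall x, 0 <= Q x -> 0 <= '[d x, x]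
  & forall x, 0 <= Q x -> '[d x, x] = 0 <-> F (tsq x)].
  have [[v [[v0 Fv] v_gt0]]|noT] := pselect (exists v, T v /\ 0 < Q v).
    exists P; split => // x x0; split=> [/Pin xs|Fx]; last first.
      by rewrite Pker ?dot0l//; apply: Ts.
    have vsT y : y \in v :: s -> T y by rewrite inE => /predU1P[->|/sT].
    apply: (span_T (v :: s)) => //.
      by rewrite span_cons; apply: subvP (addvSr _ _) _ xs.
    right; rewrite big_cons ltr_pwDl// big_seq.
    by apply: sumr_ge0 => y /sT[].
  exists (P + D); split; first exact: self_adjointD.
    by move=> x x0; rewrite add_lfunE dotDl addr_ge0.
  move=> x x0; rewrite add_lfunE dotDl; split=> [/eqP|Fx].
    rewrite paddr_eq0// => /andP[/eqP/Pin xs /eqP Qx].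
    by apply: (span_T s) => //; left.
  rewrite Pker ?dot0l ?add0r; last by apply: Ts.
  apply/eqP; rewrite eq_le x0 andbT leNgt; apply/negP => x_gt0.
  by apply: noT; exists x.
exists d.
  split=> // A /cp_sum_tensor[t [t0 ->]]; rewrite trace_form_sum// big_seq.
  by apply: sumr_ge0 => x /t0; apply: d_ge0.
apply/seteqP; split=> A.
  move=> FA; split; first exact: FC.
  have /cp_sum_tensor[t [t0 AE]] := FC _ FA.
  rewrite /= AE trace_form_sum// big_seq big1// => x xt.
  by apply/dF; [exact: t0|apply: (Fmem t) => //; rewrite -AE].
move=> [/cp_sum_tensor[t [t0 ->]]] /=; rewrite trace_form_sum// => /eqP.
rewrite big_seq psumr_eq0 => [/allP tr0|x /t0]; last exact: d_ge0.
apply: Fsum => x xt; apply/dF; first exact: t0.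
by apply/eqP; have /implyP := tr0 x xt; apply.
Qed.

End Faces.

(** * Maximising a cubic form *)

Lemma continuous_bigsum (R : realType) (T : topologicalType) (I : Type)
    (r : seq I) (f : I -> T -> R) :
  (forall i, continuous (f i)) -> continuous (fun x => \sum_(i <- r) f i x).
Proof.
move=> cf; elim: r => [|i r IH] x.
  by under eq_fun do rewrite big_nil; exact: cvg_cst.
by under eq_fun do rewrite big_cons; apply: continuousD; [exact: cf|exact: IH].
Qed.

Lemma continuous_mul (R : realType) (T : topologicalType) (f g : T -> R) x :
  {for x, continuous f} -> {for x, continuous g} ->
  {for x, continuous (fun y => f y * g y)}.
Proof. by move=> cf cg; exact: cvgM. Qed.

(** A function that is nonnegative near [0] and vanishes at [0] has derivative
    [0] there; the polynomial [h] collects the terms of order at least [2]. *)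
Lemma linear_term_eq0 (R : realType) (l : R) (h : {poly R}) :
  (forall t, 0 <= l * t + t ^+ 2 * h.[t]) -> l = 0.
Proof.
move=> lh; have [M hM] := poly_disk_bound h 1.
have M0 : 0 <= M by apply: le_trans (hM 0 _); rewrite ?normr0.
apply/eqP/negPn/negP => l0.
(* At [t = - l / H] the linear term is [- t^2 H], which outweighs [t^2 h(t)]. *)
pose H := 1 + M + `|l|.
have H0 : 0 < H by rewrite /H; have := normr_ge0 l; lra.
pose t := - l / H.
have t1 : `|t| <= 1.
  by rewrite normrM normrN normfV (gtr0_norm H0) ler_pdivrMr// mul1r /H; lra.
have ht : h.[t] <= M by rewrite (le_trans (ler_norm _)) ?hM.
have := lh t; apply/negP; rewrite -ltNge.
have : t ^+ 2 * h.[t] <= t ^+ 2 * M by rewrite ler_wpM2l ?sqr_ge0.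
have -> : l * t = - (t ^+ 2 * H) by rewrite /t; field; rewrite gt_eqF.
have : 0 < t ^+ 2.
  by rewrite exprn_even_gt0//= /t mulf_neq0 ?oppr_eq0// invr_eq0 gt_eqF.
have := normr_ge0 l; rewrite /H; nra.
Qed.

Section MaximumOfCubic.
Variables (R : realType) (V : vectType R) (dot : {dot V for idfun}).
Variables (m : {bilinear V -> V -> V}) (U : {vspace V}).
Local Notation "'[ x , y ]" := (dot x y).
Local Notation f x := ('[m x x, x]).

(** Maximising [f^2 / |.|^6] instead of [f] makes the quotient invariant under
    every nonzero scaling.  It may thus be maximised over the unit sphere of the
    maximum norm in coordinates, whose compactness needs no comparison of norms,
    and the resulting inequality is polynomial. *)
Lemma cubic_maximiser : U != 0%VS -> exists x, [/\ x \in U, x != 0 &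
  forall y, y \in U -> f y ^+ 2 * '[x, x] ^+ 3 <= f x ^+ 2 * '[y, y] ^+ 3].
Proof.
move=> U0; pose n := \dim U.
have n0 : (0 < n)%N by rewrite lt0n dimv_eq0.
pose b := vbasis U; have bB : basis_of U b := vbasisP U.
pose vec (r : 'rV[R]_n) : V := \sum_(i < n) r 0 i *: b`_i.
have vecU r : vec r \in U.
  apply: memv_suml => i _; rewrite memvZ// vbasis_mem// mem_nth//.
  by rewrite size_tuple.
have vecZ k r : vec (k *: r) = k *: vec r.
  by rewrite scaler_sumr; apply: eq_bigr => i _; rewrite mxE scalerA.
have vec_onto y : y \in U -> exists r, y = vec r.
  move=> yU; exists (\row_i coord b i y); rewrite {1}(coord_basis bB yU).
  by apply: eq_bigr => i _; rewrite mxE.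
have vec_eq0 r : vec r = 0 -> r = 0.
  move=> r0; apply/rowP => i; rewrite mxE.
  by have /freeP := basis_free bB; apply.
have coord_cont i : continuous (fun r : 'rV[R]_n => r 0 i).
  exact: coord_continuous.
have coord_mul i (g : 'rV[R]_n -> R) :
    continuous g -> continuous (fun r : 'rV[R]_n => r 0 i * g r).
  by move=> cg r; exact: (continuous_mul (coord_cont i r) (cg r)).
have coordZ i (a : R) : continuous (fun r : 'rV[R]_n => r 0 i * a).
  by apply: coord_mul; exact: cst_continuous.
have norm_cont : continuous (fun r => '[vec r, vec r]).
  have -> : (fun r => '[vec r, vec r]) = fun r : 'rV[R]_n =>
      \sum_(i < n) \sum_(j < n) r 0 i * (r 0 j * '[b`_i, b`_j]).
    apply/funext => r; rewrite linear_sumlz; apply: eq_bigr => i _.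
    rewrite linear_sumr; apply: eq_bigr => j _ /=.
    by rewrite !dotE mulrCA.
  apply: continuous_bigsum => i; apply: continuous_bigsum => j.
  exact/coord_mul/coordZ.
have cubic_cont : continuous (fun r => f (vec r)).
  have -> : (fun r => f (vec r)) = fun r : 'rV[R]_n =>
      \sum_(i < n) \sum_(j < n) \sum_(k < n)
        r 0 i * (r 0 j * (r 0 k * '[m b`_i b`_j, b`_k])).
    apply/funext => r; rewrite [X in m X]/vec linear_sumlz linear_sumlz.
    apply: eq_bigr => i _.
    rewrite (linear_sumr m) (linear_sumlz dot); apply: eq_bigr => j _.
    rewrite linear_sumr; apply: eq_bigr => k _ /=.
    by rewrite (linearZl_LR m) (linearZr_LR m) /= !dotE; ring.
  do 3 apply: continuous_bigsum => ?.
  exact/coord_mul/coord_mul/coordZ.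
pose F (r : 'rV[R]_n) := f (vec r) ^+ 2 / '[vec r, vec r] ^+ 3.
pose A : set 'rV[R]_n := [set r | `|r| = 1].
have A0 : A !=set0.
  pose r : 'rV[R]_n := const_mx 1.
  have r0 : r != 0.
    apply/eqP => /rowP /(_ (Ordinal n0)); rewrite !mxE => /eqP.
    by rewrite oner_eq0.
  exists (`|r|^-1 *: r); rewrite /A /= normrZ normfV normr_id mulVf//.
  by rewrite normr_eq0.
have cA : compact A.
  apply: bounded_closed_compact.
    by exists 1; split => // M M1 r /= ->; apply: ltW.
  have -> : A = Num.norm @^-1` [set 1] by [].
  by apply: preimage_closed; [move=> *; exact: norm_continuous|exact: closed_eq].
have Anorm_gt0 r : r != 0 -> 0 < '[vec r, vec r].
  move=> r0; apply: dot_gt0; apply: contraNneq r0 => /vec_eq0 ->.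
  exact: eqxx.
have A_neq0 r : A r -> r != 0.
  by rewrite /A /= => r1; rewrite -normr_eq0 r1 oner_eq0.
have cF : {within A, continuous F}.
  apply: continuous_in_subspaceT => r /set_mem /A_neq0 /Anorm_gt0 r0.
  apply: (continuous_mul (f := fun r => f (vec r) ^+ 2)).
    exact: (continuous_mul (cubic_cont r) (cubic_cont r)).
  apply: continuousV; first by rewrite expf_neq0// gt_eqF.
  apply: continuous_mul (norm_cont r) _.
  exact: (continuous_mul (norm_cont r) (norm_cont r)).
have [r /set_mem rA rmax] := EVT_max_rV A0 cA cF.
have r_gt0 := Anorm_gt0 r (A_neq0 r rA).
exists (vec r); split; first exact: vecU.
  by apply: contra_ltN r_gt0 => /eqP ->; rewrite dot0l.
move=> y /vec_onto[q ->].
have [->|q0] := eqVneq q 0.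
  have -> : vec 0 = 0 by rewrite /vec big1// => i _; rewrite mxE scale0r.
  by rewrite dot0r expr0n mul0r /= mulr_ge0 ?sqr_ge0// exprn_ge0// dot_ge0.
have : A (`|q|^-1 *: q) by rewrite /A /= normrZ normfV normr_id mulVf ?normr_eq0.
move=> /mem_set /rmax; rewrite /F vecZ.
set k := _^-1; have k0 : k != 0 by rewrite invr_eq0 normr_eq0.
have q_gt0 := Anorm_gt0 q q0.
rewrite (linearZl_LR m) (linearZr_LR m) /= !dotE.
have -> : (k * (k * (k * f (vec q)))) ^+ 2 / (k * (k * '[vec q, vec q])) ^+ 3 =
  f (vec q) ^+ 2 / '[vec q, vec q] ^+ 3 by field; rewrite gt_eqF.
by rewrite ler_pdivrMr ?exprn_gt0// mulrAC ler_pdivlMr ?exprn_gt0.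
Qed.

End MaximumOfCubic.

(** * Peirce decomposition and primitive idempotents *)

Section EuclideanJordanAlgebra.
Variables (R : realType) (E : vectType R) (J : eja E).
Local Notation dot := (eja_dot J).
Local Notation "'[ x , y ]" := (dot x y).
Local Notation mul := (eja_mul J).
Local Notation "x ∘ y" := (eja_mul J x y) (at level 40, left associativity).
Local Notation e := (eja_one J).

Lemma jmulDl x y z : (x + y) ∘ z = x ∘ z + y ∘ z. Proof. exact: linearDl. Qed.
Lemma jmulDr x y z : x ∘ (y + z) = x ∘ y + x ∘ z. Proof. exact: linearDr. Qed.
Lemma jmulBl x y z : (x - y) ∘ z = x ∘ z - y ∘ z. Proof. exact: linearBl. Qed.
Lemma jmulBr x y z : x ∘ (y - z) = x ∘ y - x ∘ z. Proof. exact: linearBr. Qed.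
Lemma jmulNl x y : (- x) ∘ y = - (x ∘ y). Proof. exact: linearNl. Qed.
Lemma jmulNr x y : x ∘ (- y) = - (x ∘ y). Proof. exact: linearNr. Qed.
Lemma jmulZl a x y : (a *: x) ∘ y = a *: (x ∘ y). Proof. exact: linearZl_LR. Qed.
Lemma jmulZr a x y : x ∘ (a *: y) = a *: (x ∘ y). Proof. exact: linearZr_LR. Qed.
Lemma jmul0l x : 0 ∘ x = 0. Proof. exact: linear0l. Qed.
Lemma jmul0r x : x ∘ 0 = 0. Proof. exact: linear0r. Qed.
Definition jmulE := (jmulDl, jmulDr, jmulBl, jmulBr, jmulNl, jmulNr, jmulZl, jmulZr,
  jmul0l, jmul0r).

Lemma dot_congr v x y : x = y -> '[x, v] = '[y, v].
Proof. by move=> ->. Qed.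

Lemma mule1 x : x ∘ e = x. Proof. by rewrite eja_mulC eja_mul1. Qed.

(** The part of the Jordan identity at [x + y] that is linear in [y]: half the
    difference of the identities at [x + y] and [x - y], minus the identity at
    [y]. *)
Lemma jordan_linearized x y w :
  y ∘ ((x ∘ x) ∘ w) + 2 *: (x ∘ ((x ∘ y) ∘ w)) =
  (x ∘ x) ∘ (y ∘ w) + 2 *: ((x ∘ y) ∘ (x ∘ w)).
Proof.
apply: (@dot_ext _ _ dot) => v.
have := dot_congr v (eja_jordan J (x + y) w).
have := dot_congr v (eja_jordan J (x - y) w).
have := dot_congr v (eja_jordan J y w).
rewrite !jmulE (eja_mulC _ y x) !dotE; lra.
Qed.

(** Multiplication by an idempotent is annihilated by [2 t^3 - 3 t^2 + t], so its
    eigenvalues are [0], [1/2] and [1]. *)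
Lemma peirce_cubic c y : c ∘ c = c ->
  2 *: (c ∘ (c ∘ (c ∘ y))) = 3 *: (c ∘ (c ∘ y)) - c ∘ y.
Proof.
move=> cc; have := jordan_linearized c y c.
rewrite !cc (eja_mulC _ y c) !(eja_mulC _ (c ∘ y) c) => H.
 apply: (@dot_ext _ _ dot) => v.
have := dot_congr v H; rewrite !dotE; lra.
Qed.

Lemma peirce1_sqr c x : c ∘ c = c -> c ∘ x = x -> c ∘ (x ∘ x) = x ∘ x.
Proof.
move=> cc cx; have := jordan_linearized c x x.
rewrite !cc !cx => H; apply: (@dot_ext _ _ dot) => v.
have := dot_congr v H; rewrite !dotE; lra.
Qed.

(** The Peirce half-component of [z^2] vanishes, since [t - t^2] is nonzero only
    at the eigenvalue [1/2]. *)
Lemma peirce_half_sqr c z : c ∘ c = c -> c ∘ z = 2^-1 *: z ->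
  c ∘ (c ∘ (z ∘ z)) = c ∘ (z ∘ z).
Proof.
move=> cc cz; have := jordan_linearized z c c.
rewrite !cc (eja_mulC _ z c) cz !jmulE (eja_mulC _ (z ∘ z) c) (eja_mulC _ z c) cz.
rewrite !jmulE => H; apply: (@dot_ext _ _ dot) => v.
have := dot_congr v H; rewrite !dotE; lra.
Qed.

Lemma dot_mulC x y z : '[x ∘ y, z] = '[y, x ∘ z].
Proof. by rewrite eja_mulC eja_dotA. Qed.

Local Notation f x := ('[x ∘ x, x]).

Lemma cubicD x y t : f (x + t *: y) =
  f x + 3 * t * '[x ∘ x, y] + 3 * t ^+ 2 * '[x, y ∘ y] + t ^+ 3 * f y.
Proof.
rewrite !jmulE (eja_mulC _ y x) !dotE.
have -> : '[x ∘ y, x] = '[x ∘ x, y] by rewrite dot_mulC dotC.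
have -> : '[x ∘ y, y] = '[x, y ∘ y] by rewrite eja_dotA.
by rewrite (dotC _ (y ∘ y) x); ring.
Qed.

(** First-order condition at a maximiser: the component [y] of [x^2] orthogonal to
    [x] is proportional to the gradient of the cubic form along the sphere, so
    moving from [x] in the direction of [y] shows [|y|^2 = 0]. *)
Lemma cubic_critical (U : {vspace E}) x : x \in U -> x ∘ x \in U -> x != 0 ->
  f x != 0 ->
  (forall y, y \in U -> f y ^+ 2 * '[x, x] ^+ 3 <= f x ^+ 2 * '[y, y] ^+ 3) ->
  x ∘ x = (f x / '[x, x]) *: x.
Proof.
move=> xU xxU x0 fx0 xmax; have s0 := dot_gt0 dot x0.
set s := '[x, x] in xmax s0 *; set a := f x in fx0 xmax *.
have [y yE] : exists y, y = x ∘ x - (a / s) *: x by eexists.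
have yU : y \in U by rewrite yE memvB// memvZ.
have xy0 : '[x, y] = 0.
  by rewrite yE dotBr dotZr (dotC _ x (x ∘ x)) -/a -/s; field; rewrite gt_eqF.
pose q := '[y, y].
have by_ : '[x ∘ x, y] = q.
  by rewrite /q {2}yE dotBl dotZl xy0 mulr0 subr0.
pose c := '[x, y ∘ y]; pose d := f y.
(* The coefficients of [f(x)^2 |x + ty|^6 - f(x + ty)^2 |x|^6] in [t]. *)
have := @linear_term_eq0 _ (- (6 * a * q * s ^+ 3))
  (Poly [:: 3 * a ^+ 2 * s ^+ 2 * q - (9 * q ^+ 2 + 6 * a * c) * s ^+ 3;
     - (2 * a * d + 18 * q * c) * s ^+ 3;
     3 * a ^+ 2 * s * q ^+ 2 - (9 * c ^+ 2 + 6 * q * d) * s ^+ 3;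
     - (6 * c * d) * s ^+ 3;
     a ^+ 2 * q ^+ 3 - d ^+ 2 * s ^+ 3]).
case/(_ _)/Wrap => [t|].
  rewrite horner_Poly /=.
  have /xmax : x + t *: y \in U by rewrite memvD// memvZ.
  rewrite cubicD by_ -/a -/c -/d.
  have -> : '[x + t *: y, x + t *: y] = s + t ^+ 2 * q.
    by rewrite !dotE (dotC _ y x) xy0 -/s -/q; ring.
  rewrite -subr_ge0; congr (0 <= _); ring.
move=> l0; apply/eqP; rewrite -subr_eq0 -yE; apply/eqP/(@dot_eq0 _ _ dot).
have as0 : 6 * a * s ^+ 3 != 0.
  apply: mulf_neq0; last by rewrite expf_neq0 ?gt_eqF.
  by apply: mulf_neq0; rewrite ?pnatr_eq0.
by apply: (mulfI as0); rewrite mulr0 -/q -oppr0 -l0; ring.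
Qed.

(** Second-order condition at an idempotent: for [y] orthogonal to [c] in its
    Peirce [1]-space, [f(c + ty)^2 |c|^2] grows like [|c|^6 + 6 t^2 |c|^4 |y|^2],
    but [|c + ty|^6] only like [|c|^6 + 3 t^2 |c|^4 |y|^2]. *)
Lemma cubic_not_max_at_idempotent c y : c ∘ c = c -> '[c, y] = 0 ->
  c ∘ y = y -> y != 0 -> exists t,
  '[c + t *: y, c + t *: y] ^+ 3 < f (c + t *: y) ^+ 2 * '[c, c].
Proof.
move=> cc cy0 cy y0; have q0 := dot_gt0 dot y0; set q := '[y, y] in q0 *.
have c0 : c != 0 by apply: contra_neq y0 => c0; rewrite -cy c0 jmul0l.
have n0 := dot_gt0 dot c0; set n := '[c, c] in n0 *.
(* With [t^2 |y|^2 = |c|^2 / 2] the comparison is between [(5/2)^2] and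
   [(3/2)^3]; the sign of [t] makes the cubic term help. *)
pose t0 := Num.sqrt (n / (2 * q)).
have t02 : t0 ^+ 2 = n / (2 * q).
  by rewrite sqr_sqrtr// divr_ge0// ?mulr_ge0 ?(ltW n0) ?(ltW q0).
pose t := if 0 <= f y then t0 else - t0.
have tq : t ^+ 2 * q = n / 2.
  rewrite /t; case: ifP => _; rewrite ?sqrrN t02; field; exact: lt0r_neq0.
have td : 0 <= t ^+ 3 * f y.
  have t00 : 0 <= t0 ^+ 3 by rewrite exprn_ge0 ?sqrtr_ge0.
  rewrite /t; case: ifP => [d0|/negbT]; first by rewrite mulr_ge0.
  rewrite -ltNge => d0; have -> : (- t0) ^+ 3 = - t0 ^+ 3 by ring.
  by rewrite mulNr oppr_ge0 mulr_ge0_le0// ltW.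
exists t; rewrite cubicD.
have -> : '[c ∘ c, y] = 0 by rewrite cc.
have -> : '[c, y ∘ y] = q by rewrite dotC eja_dotA (eja_mulC _ y c) cy.
have -> : '[c ∘ c, c] = n by rewrite cc.
have -> : '[c + t *: y, c + t *: y] = n + t ^+ 2 * q.
  by rewrite !dotE (dotC _ y c) cy0 -/n -/q; ring.
have -> : n + 3 * t * 0 + 3 * t ^+ 2 * q + t ^+ 3 * f y =
  n + 3 * (t ^+ 2 * q) + t ^+ 3 * f y by ring.
rewrite tq; move: td; set d := _ * f y => d0.
have n30 : 0 < n ^+ 3 by rewrite exprn_gt0.
have : 0 <= n ^+ 2 * d by rewrite mulr_ge0 ?sqr_ge0.
have : 0 <= n * d ^+ 2 by rewrite mulr_ge0 ?sqr_ge0 ?ltW.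
have -> : (n + 3 * (n / 2) + d) ^+ 2 * n = 25/4 * n ^+ 3 + 5 * (n ^+ 2 * d) + n * d ^+ 2.
  by field.
have -> : (n + n / 2) ^+ 3 = 27/8 * n ^+ 3 by field.
lra.
Qed.

(** Otherwise some [y] in the Peirce [1]-space is nonzero and orthogonal to [c].
    A maximiser of the cubic form is then not on the line of [c], yet it is
    proportional to an idempotent [a], and [c = a + (c - a)] contradicts
    primitivity. *)
Lemma primitive_peirce1 c x : primitive_idempotent J c -> c ∘ x = x ->
  x = ('[c, x] / '[c, c]) *: c.
Proof.
move=> [[/eqP c0 cc] cprim] cx.
have n0 := dot_gt0 dot c0; set n := '[c, c] in n0 *.
apply/eqP; rewrite -subr_eq0; apply/negPn/negP.
set y := x - _; move=> y0.
have cy : c ∘ y = y by rewrite /y jmulBr jmulZr cx cc.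
have cy0 : '[c, y] = 0.
  by rewrite /y dotBr dotZr -/n; field; rewrite gt_eqF.
pose U := lker (linfun (mul c) - \1)%VF.
have UP z : (z \in U) = (c ∘ z == z).
  by rewrite memv_ker add_lfunE opp_lfunE id_lfunE lfunE /= subr_eq0.
have cU : c \in U by rewrite UP cc.
have U0 : U != 0%VS.
  by apply: contraNneq c0 => U0; rewrite -memv0 -U0.
have [z [zU z0 zmax]] := cubic_maximiser dot mul U0.
have cz : c ∘ z = z by apply/eqP; rewrite -UP.
have s0 := dot_gt0 dot z0.
have a0 : f z != 0.
  apply/eqP => a0; have := zmax c cU; rewrite a0 expr0n mul0r cc -/n.
  by apply/negP; rewrite -ltNge mulr_gt0 ?exprn_gt0.
have zzU : z ∘ z \in U by rewrite UP peirce1_sqr.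
have zz := cubic_critical zU zzU z0 a0 zmax.
pose k := '[z, z] / f z.
have k0 : k != 0 by rewrite mulf_neq0 ?invr_eq0// gt_eqF.
pose a := k *: z.
have aa : a ∘ a = a.
  rewrite /a !jmulE zz !scalerA; congr (_ *: _); rewrite /k; field.
  by rewrite a0 gt_eqF.
have ca : c ∘ a = a by rewrite /a jmulZr cz.
have aNc : c - a != 0.
  apply: contra_neq y0 => /eqP; rewrite subr_eq0 => /eqP ca'.
  have [//|y0] := eqVneq y 0.
  have [t] := cubic_not_max_at_idempotent cc cy0 cy y0.
  set v := c + t *: y; have vU : v \in U.
    by rewrite UP /v jmulDr jmulZr cy cc.
  clearbody v.
  have zE : z = k^-1 *: c by rewrite ca' /a scalerA mulVf// scale1r.
  have := zmax v vU; rewrite zE !jmulE cc !dotE -/n => le lt.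
  have : f v ^+ 2 * n <= '[v, v] ^+ 3.
    have kn : 0 < k^-1 ^+ 6 * n ^+ 2.
      by rewrite mulr_gt0 ?exprn_even_gt0//= ?invr_eq0// gt_eqF.
    rewrite -(ler_pM2l kn).
    have -> : k^-1 ^+ 6 * n ^+ 2 * (f v ^+ 2 * n) =
       f v ^+ 2 * (k^-1 * (k^-1 * n)) ^+ 3 by ring.
    by rewrite (le_trans le)// le_eqVlt; apply/orP; left; apply/eqP; ring.
  by rewrite leNgt lt.
apply: cprim; exists a, (c - a); split; last by rewrite addrC subrK.
  by split => //; apply/eqP; rewrite scaler_eq0 negb_or k0.
split; first exact/eqP.
by rewrite jmulBl !jmulBr cc ca (eja_mulC _ a c) ca aa subrr subr0.
Qed.

(** * The quadratic equation in rank at most two *)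

Lemma frame_orthogonal c1 c2 : c1 ∘ c1 = c1 -> c1 ∘ c2 = 0 -> '[c1, c2] = 0.
Proof. by move=> c11 c12; rewrite -c11 dot_mulC c12 dot0r. Qed.

(** The vector [u] represents the trace, a linear form for which every element
    satisfies a quadratic equation.  On multiples of the unit the equation leaves
    the trace undetermined; the first condition fixes it there, and is stated
    so as to include the zero algebra. *)
Definition quadratic_trace (u : E) :=
  '[u, e] *: e = 2 *: e /\ forall x, exists q, x ∘ x = '[u, x] *: x - q *: e.

(** For [x = a c1 + b c2 + z] with [z] in the half-space and [z^2 = g e], one has
    [x^2 = (a + b) x - (a b - g) e]. *)
Lemma quadratic_trace_rank2 c1 c2 :
  primitive_idempotent J c1 -> primitive_idempotent J c2 ->
  c1 ∘ c2 = 0 -> c1 + c2 = e -> exists u, quadratic_trace u.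
Proof.
move=> p1 p2 c12 ce.
have [[/eqP c1_neq0 c11] _] := p1; have [[/eqP c2_neq0 c22] _] := p2.
have n1 := dot_gt0 dot c1_neq0; have n2 := dot_gt0 dot c2_neq0.
have c2E x : c2 ∘ x = x - c1 ∘ x.
  by rewrite -[X in X - _](eja_mul1 J) -ce jmulDl addrC addKr.
have line1 x : c1 ∘ x = x -> exists a, x = a *: c1.
  by move=> /(primitive_peirce1 p1) ->; eexists.
have line2 x : c1 ∘ x = 0 -> exists a, x = a *: c2.
  move=> c1x; have /(primitive_peirce1 p2) -> : c2 ∘ x = x by rewrite c2E c1x subr0.
  by eexists.
have o12 := frame_orthogonal c11 c12.
have oz z : c1 ∘ z = 2^-1 *: z -> '[c1, z] = 0 /\ '[c2, z] = 0.
  move=> c1z; split.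
    have : '[c1, z] = 2^-1 * '[c1, z] by rewrite -{1}c11 eja_dotA c1z dotZr.
    lra.
  have : '[c2, z] = 2^-1 * '[c2, z].
    by rewrite -{1}c22 eja_dotA c2E c1z dotBr dotZr; lra.
  lra.
have half_sqr z : c1 ∘ z = 2^-1 *: z -> exists g, z ∘ z = g *: e.
  move=> c1z; have ccw := peirce_half_sqr c11 c1z.
  have [al alE] := line1 _ ccw.
  have [be beE] : exists be, z ∘ z - c1 ∘ (z ∘ z) = be *: c2.
    by apply: line2; rewrite jmulBr ccw subrr.
  have zzE : z ∘ z = al *: c1 + be *: c2 by rewrite -alE -beE addrC subrK.
  have [z0|z0] := eqVneq z 0; first by exists 0; rewrite z0 jmul0l scale0r.
  (* The Jordan identity for [z] and [c1] equates the two coefficients. *)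
  exists al; rewrite zzE -ce scalerDr; congr (_ + _ *: _).
  have zc1 : z ∘ c1 = 2^-1 *: z by rewrite eja_mulC.
  have zc2 : z ∘ c2 = 2^-1 *: z.
    rewrite eja_mulC c2E c1z; apply: (@dot_ext _ _ dot) => v.
    by rewrite !dotE; lra.
  have := dot_congr z (eja_jordan J z c1).
  rewrite zzE zc1 !jmulE c11 (eja_mulC _ c2 c1) c12 zc1 c1z (eja_mulC _ c2 z) zc2 jmul0r.
  rewrite !dotE => H; apply: (mulIf (lt0r_neq0 (dot_gt0 dot z0))); lra.
exists ('[c1, c1]^-1 *: c1 + '[c2, c2]^-1 *: c2); set u := _ + _.
have uE a b z : c1 ∘ z = 2^-1 *: z -> '[u, a *: c1 + b *: c2 + z] = a + b.
  move=> /oz[c1z c2z]; rewrite /u !dotE o12 (dotC _ c2 c1) o12 c1z c2z.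
  by field; rewrite !gt_eqF.
split.
  congr (_ *: _); rewrite -ce -[c1 + c2]addr0.
  have := @uE 1 1 0; rewrite !scale1r => ->; first by lra.
  by rewrite jmul0r scaler0.
move=> x.
(* The three components of [x] are the values at [c1] of the interpolation
   polynomials [2 t^2 - t], [1 - 3 t + 2 t^2] and [4 (t - t^2)] at the
   eigenvalues [1], [0] and [1/2]. *)
pose y := c1 ∘ x; pose w := c1 ∘ y.
have cw : 2 *: (c1 ∘ w) = 3 *: w - y by rewrite peirce_cubic.
have cwE v : '[c1 ∘ w, v] = 2^-1 * (3 * '[w, v] - '[y, v]).
  by have := dot_congr v cw; rewrite !dotE; lra.
have [a aE] : exists a, 2 *: w - y = a *: c1.
  apply: line1; rewrite jmulBr jmulZr -/w cw; apply: (@dot_ext _ _ dot) => v.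
  by rewrite !dotE; lra.
have [b bE] : exists b, x - 3 *: y + 2 *: w = b *: c2.
  apply: line2; rewrite jmulDr jmulBr !jmulZr -/y -/w cw.
  by apply: (@dot_ext _ _ dot) => v; rewrite !dotE; lra.
have [z zE] : exists z, z = 4 *: (y - w) by eexists.
have c1z : c1 ∘ z = 2^-1 *: z.
  rewrite zE jmulZr jmulBr -/w; apply: (@dot_ext _ _ dot) => v.
  by rewrite !dotE cwE; lra.
have xE : x = a *: c1 + b *: c2 + z.
  rewrite -aE -bE zE; apply: (@dot_ext _ _ dot) => v.
  by rewrite !dotE; lra.
have c2z : c2 ∘ z = 2^-1 *: z.
  rewrite c2E c1z; apply: (@dot_ext _ _ dot) => v.
  by rewrite !dotE; lra.
have [g gE] := half_sqr z c1z.
exists (a * b - g); rewrite xE uE// !jmulE.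
rewrite c11 c22 c12 (eja_mulC _ c2 c1) c12 (eja_mulC _ z c1) (eja_mulC _ z c2).
rewrite c1z c2z gE -ce; apply: (@dot_ext _ _ dot) => v.
by rewrite !dotE; field.
Qed.

Lemma quadratic_trace_rank_le2 r : (r <= 2)%N -> eja_has_rank J r ->
  exists u, quadratic_trace u.
Proof.
case: r => [|[|[|//]]] _ [c [prim orth sum_c]].
- have e0 : e = 0 by rewrite -sum_c big_ord0.
  exists 0; split; first by rewrite e0 !scaler0.
  by move=> x; exists 0; rewrite -(eja_mul1 J x) e0 !jmul0l !scaler0 subr0.
- have ce : c ord0 = e by rewrite -sum_c big_ord1.
  have := prim ord0; rewrite ce => p; have [[/eqP /(dot_gt0 dot) n0 _] _] := p.
  exists ((2 / '[e, e]) *: e); split.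
    by rewrite dotZl divfK// gt_eqF.
  move=> x; have -> := primitive_peirce1 p (eja_mul1 J x).
  set k := '[e, x] / _; exists (k ^+ 2); rewrite !jmulE eja_mul1 !dotE.
  apply: (@dot_ext _ _ dot) => v; rewrite !dotE; field.
  by rewrite gt_eqF.
- apply: (@quadratic_trace_rank2 (c ord0) (c (lift ord0 ord0))) => //.
    exact: orth.
  by rewrite -sum_c big_ord_recl big_ord1.
Qed.

(** * The cone of squares and the determinant *)

Section QuadraticTrace.
Variables (u : E) (uP : quadratic_trace u).

(** Pairing the quadratic equation with [e] gives
    [|e|^2 det x = <u, x> <e, x> - |x|^2].  The associated self-adjoint map comes
    from writing the product of the two linear forms as a difference of
    squares. *)
Definition det_map : 'End(E) :=
  4^-1 *: (tensor_square dot (u + e) + (-1) *: tensor_square dot (u - e))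
    + (-1) *: \1%VF.

Lemma self_adjoint_det_map : self_adjoint dot det_map.
Proof.
apply: self_adjointD; last by apply: self_adjointZ; exact: self_adjoint_id.
apply: self_adjointZ; apply: self_adjointD; first exact: self_adjoint_tensor.
by apply: self_adjointZ; exact: self_adjoint_tensor.
Qed.

Lemma det_mapE x : '[det_map x, x] = '[u, x] * '[e, x] - '[x, x].
Proof.
rewrite !add_lfunE !scale_lfunE !add_lfunE scale_lfunE !tensor_squareE id_lfunE.
by rewrite !dotE; field.
Qed.

Lemma det_mapP x q : x ∘ x = '[u, x] *: x - q *: e ->
  '[det_map x, x] = q * '[e, e].
Proof.
move=> xx; rewrite det_mapE.
have : '[x ∘ x, e] = '[x, x] by rewrite eja_dotA mule1.
by rewrite xx !dotE (dotC _ x e) => <-; ring.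
Qed.

(** Squaring [y^2 = t y - q e] gives [x^2 = (t^2 - 2q) x - q^2 e] for [x = y^2].
    If [x] is not a multiple of [e], comparing coefficients yields
    [det x = q^2]; on the line of [e] the determinant is a square anyway. *)
Lemma square_det_ge0 y : 0 <= '[det_map (y ∘ y), y ∘ y].
Proof.
have [ue quad] := uP; have [q yy] := quad y; have [p xx] := quad (y ∘ y).
set x := y ∘ y in xx *; set t := '[u, y] in yy.
have xx' : x ∘ x = (t ^+ 2 - 2 * q) *: x - q ^+ 2 *: e.
  rewrite {1 2}[x]yy !jmulE !eja_mul1 !mule1 -/x.
  apply: (@dot_ext _ _ dot) => v.
  have := dot_congr v yy; rewrite !dotE -/x => ->; ring.
have [k0|k0] := eqVneq (t ^+ 2 - 2 * q - '[u, x]) 0.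
  rewrite (@det_mapP x (q ^+ 2)); first by rewrite mulr_ge0 ?sqr_ge0// dot_ge0.
  by rewrite xx'; congr (_ *: _ - _); apply/eqP; rewrite -subr_eq0 k0.
have [k xE] : exists k, x = k *: e.
  exists ((q ^+ 2 - p) / (t ^+ 2 - 2 * q - '[u, x])).
  apply: (@dot_ext _ _ dot) => v; rewrite !dotE.
  have := dot_congr v xx'; rewrite xx !dotE => H.
  apply: (mulfI k0); rewrite mulrA mulrCA mulfV// mulr1.
  lra.
rewrite det_mapE xE !dotE.
have : '[u, e] * '[e, e] = 2 * '[e, e].
  by have := dot_congr e ue; rewrite !dotE.
move=> ue2.
have -> : k * '[u, e] * (k * '[e, e]) - k * (k * '[e, e]) =
   k ^+ 2 * ('[u, e] * '[e, e] - '[e, e]) by ring.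
by rewrite mulr_ge0 ?sqr_ge0// ue2; have := dot_ge0 dot e; lra.
Qed.

(** With [d] the square root of [det x], the quadratic equation gives
    [(x + d e)^2 = (tr x + 2 d) x]. *)
Lemma det_ge0_square x : 0 <= '[det_map x, x] -> 0 <= '[u, x] ->
  exists y, y ∘ y = x.
Proof.
move=> dx tx; have [ue quad] := uP; have [q xx] := quad x.
have [e0|e0] := eqVneq e 0.
  by exists 0; rewrite jmul0l -(eja_mul1 J x) e0 jmul0l.
have q0 : 0 <= q.
  by move: dx; rewrite (det_mapP xx) pmulr_lge0// dot_gt0.
pose d := Num.sqrt q; have d0 : 0 <= d := sqrtr_ge0 q.
have d2 : d ^+ 2 = q by rewrite sqr_sqrtr.
pose k := '[u, x] + 2 * d.
have k_ge0 : 0 <= k by rewrite addr_ge0// mulr_ge0.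
have sqE : (x + d *: e) ∘ (x + d *: e) = k *: x.
  rewrite !jmulE eja_mul1 mule1 eja_mul1 xx -d2.
  by apply: (@dot_ext _ _ dot) => v; rewrite !dotE /k; ring.
have [k0|k0] := eqVneq k 0.
  have [t0 d00] : '[u, x] = 0 /\ d = 0 by move: k0; rewrite /k; split; lra.
  exists 0; rewrite jmul0l; apply/esym/(@dot_eq0 _ _ dot).
  have <- : '[x ∘ x, e] = '[x, x] by rewrite eja_dotA mule1.
  by rewrite xx t0 -d2 d00 expr0n !scale0r subrr dot0l.
have sk0 : Num.sqrt k != 0 by rewrite sqrtr_eq0 -ltNge lt_neqAle eq_sym k0.
exists ((Num.sqrt k)^-1 *: (x + d *: e)); rewrite jmulZl jmulZr sqE !scalerA.
rewrite -[RHS]scale1r; congr (_ *: _).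
by rewrite -{3}(sqr_sqrtr k_ge0); field.
Qed.

Lemma cone_of_squares_det x :
  cone_of_squares J x \/ cone_of_squares J (- x) <-> 0 <= '[det_map x, x].
Proof.
split=> [[[y _ <-]|[y _ yE]]|dx].
- exact: square_det_ge0.
- have := square_det_ge0 y; rewrite yE.
  by rewrite (linearN det_map) dotNl dotNr opprK.
have [t0|/ltW t0] := lerP 0 '[u, x].
  by left; have [y yx] := det_ge0_square dx t0; exists y.
right; have [||y yx] := @det_ge0_square (- x); last by exists y.
  by rewrite (linearN det_map) dotNl dotNr opprK.
by rewrite dotNr oppr_ge0.
Qed.

End QuadraticTrace.

End EuclideanJordanAlgebra.

Theorem theorem3p1 (R : realType) (E : vectType R) (J : eja E)
    (r : nat) (r_le2 : (r <= 2)%N) (rankJ : eja_has_rank J r) :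
  facially_exposed (self_adjoint (eja_dot J)) (@trace_form R E)
    (completely_positive_cone (eja_dot J) (cone_of_squares J)).
Proof.
have [u uP] := quadratic_trace_rank_le2 r_le2 rankJ.
apply: (cp_facially_exposed (D := det_map J u)).
  exact: self_adjoint_det_map.
exact: cone_of_squares_det.
Qed.
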